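(* The symmetrically weighted (SW) Hermite velocity spectral discretization of the Vlasov equation, applied either to $f^s$ (SW formulation) or to $\sqrt{f^s}$ (SW square-root formulation), preserves the anti-symmetric structure of the advection operator $A^s=-v\,\partial_x-\frac{q^s}{m^s}E(x,t)\,\partial_v$. That is, the vector $\Psi^s=[C_0^s,\dots,C_{N_v-1}^s]^\top$ of expansion coefficients satisfies $$\frac{\partial}{\partial t}\Psi^s(x,t)=A_v^s(x,t)\Psi^s(x,t),$$ where $A_v^s$ is the $N_v\times N_v$ tridiagonal matrix of operators (rows and columns indexed by $n=0,\dots,N_v-1$) with entries $$(A_v^s)_{n,n}=-u^s\frac{\partial}{\partial x},\qquad (A_v^s)_{n,n+1}=-\sqrt{\tfrac{n+1}{2}}\,G_+^s,\qquad (A_v^s)_{n,n-1}=\sqrt{\tfrac{n}{2}}\,G_-^s,$$ $$G_\pm^s(x,t)=\frac{q^s}{m^s\alpha^s}E(x,t)\pm\alpha^s\frac{\partial}{\partial x},$$ and $(\mathcal{W}^{N_v},A_v^s)$ is anti-symmetric in the periodic domain: $\langle A_v^s\Phi,\Theta\rangle=-\langle\Phi,A_v^s\Theta\rangle$ for all (continuously differentiable) $\Phi,\Theta\in\mathcal{W}^{N_v}$.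
   Context: Vlasov equation for species $s$: $\left(\partial_t+v\,\partial_x+\frac{q^s}{m^s}E(x,t)\,\partial_v\right)f^s=0$, with $x\in[0,\ell]$ periodic, $v\in\mathbb{R}$, $q^s\in\mathbb{R}$, $m^s>0$, and $E$ real-valued; $\sqrt{f^s}$ satisfies the same equation. SW Hermite basis: $\psi_n(\xi)=(\sqrt\pi\,2^n n!)^{-1/2}\mathcal{H}_n(\xi)e^{-\xi^2/2}$, $n\ge0$, with $\mathcal H_n$ the physicists' Hermite polynomials, evaluated at $\xi^s=(v-u^s)/\alpha^s$ with constants $u^s\in\mathbb{R}$, $\alpha^s>0$. Discretization: one inserts the ansatz $\sum_{n=0}^{N_v-1}C_n^s(x,t)\psi_n(\xi^s)$ for $f^s$ (SW) or for $\sqrt{f^s}$ (SW square-root) into the equation, multiplies by $\psi_m(\xi^s)$ for $m=0,\dots,N_v-1$, and integrates over $\xi^s\in\mathbb{R}$, with the closure by truncation $C_{N_v}^s=0$ and the convention $C_{-1}^s=0$. $\mathcal{W}^{d}$ is the space of real vector functions $g=[g_1,\dots,g_d]^\top$ with $g_i(\cdot,t)\in L^2([0,\ell])$ and $g_i(0,t)=g_i(\ell,t)$; $E\in\mathcal W^1$. Inner product: $\langle\Phi,\Theta\rangle=\sum_i\int_0^\ell\Phi_i\Theta_i\,\mathrm{d}x$. Derivatives are classical, so the anti-symmetry identity is for $\Phi,\Theta$ continuously differentiable in $x$ on $[0,\ell]$. *)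

(* Defs.v *)
(* MathComp-Analysis; the real line is an arbitrary R : realType. *)
From HB Require Import structures.
From mathcomp Require Export all_boot all_order all_algebra.
From mathcomp Require Export all_classical all_reals all_analysis.
From mathcomp Require Import lra.
Export Order.TTheory GRing.Theory Num.Theory.
Export numFieldNormedType.Exports.

Set Implicit Arguments.
Unset Strict Implicit.
Unset Printing Implicit Defensive.

Local Open Scope classical_set_scope.
Local Open Scope ring_scope.

Section Derivatives.
Context {R : realType}.
Implicit Types (D : set R) (f : R -> R) (x : R).

Definition diff_quotient f x : R -> R := fun y => (f y - f x) / (y - x).

(* Derivative of a function defined on D: the points y of the difference
   quotient stay in D.  It is the two-sided derivative at an interior point of
   D and the one-sided derivative at an endpoint of an interval; values of f
   outside D are irrelevant. *)
Definition derivable_in D f x : Prop :=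
  cvg (diff_quotient f x y @[y --> within D x^']).

Definition derive_in D f x : R :=
  lim (diff_quotient f x y @[y --> within D x^']).

Definition C1_in D f : Prop :=
  (forall x, D x -> derivable_in D f x) /\
  {within D, continuous (derive_in D f)}.

End Derivatives.

Section Hermite.
Context {R : realType}.

(* Physicists' Hermite polynomials; the recurrence is Rodrigues' formula
   H_n(z) = (-1)^n e^(z^2) (d/dz)^n e^(-z^2) differentiated once. *)
Fixpoint hermite (n : nat) : {poly R} :=
  if n is m.+1 then 2%:R *: ('X * hermite m) - (hermite m)^`() else 1.

Definition sw_hermite (n : nat) (xi : R) : R :=
  (Num.sqrt (Num.sqrt pi * 2 ^+ n * n`!%:R))^-1
  * (hermite n).[xi] * expR (- (xi ^+ 2 / 2)).

End Hermite.

Section Space.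
Context {R : realType}.
Variables (ell : R) (J : set R).

(* Square integrability on [0, ell] is that of the extension by zero.  The
   functions depend on (x, t), with t in the time domain J. *)
Definition inW (d : nat) (g : 'I_d -> R -> R -> R) : Prop :=
  forall i t, J t ->
    patch (fun=> 0) `[0, ell] (fun x => g i x t)
      \in Lfun (@lebesgue_measure R) 2%:E
    /\ g i 0 t = g i ell t.

Definition inner (d : nat) (g h : 'I_d -> R -> R -> R) (t : R) : R :=
  \sum_(i < d) \int[@lebesgue_measure R]_(x in `[0, ell]) (g i x t * h i x t).

Definition C1_space (d : nat) (g : 'I_d -> R -> R -> R) : Prop :=
  forall i t, J t -> C1_in `[0, ell] (fun x => g i x t).

(* Antisymmetry, at each time, of an operator A on vector functions. *)
Definition antisymmetric_on (d : nat)
    (A : ('I_d -> R -> R -> R) -> 'I_d -> R -> R -> R) : Prop :=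
  forall Phi Theta : 'I_d -> R -> R -> R,
    inW Phi -> inW Theta -> C1_space Phi -> C1_space Theta ->
    forall t, J t -> inner (A Phi) Theta t = - inner Phi (A Theta) t.

End Space.

Section Vlasov.
Context {R : realType}.
Variables (ell : R) (J : set R) (q m : R) (E : R -> R -> R).

Definition dx (g : R -> R -> R) (x t : R) : R :=
  derive_in `[0, ell] (fun y => g y t) x.

Definition dt (g : R -> R -> R) (x t : R) : R :=
  derive_in J (fun s => g x s) t.

(* Left-hand side of the Vlasov equation for w = w(x, v, t). *)
Definition vlasov (w : R -> R -> R -> R) (x v t : R) : R :=
  dt (fun y s => w y v s) x t
  + v * dx (fun y s => w y v s) x t
  + q / m * E x t * derive1 (fun z => w x z t) v.

Variables (u alpha : R) (N : nat).
Implicit Type C : 'I_N -> R -> R -> R.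

(* The sum has no modes below 0 or above N - 1, i.e. C_(-1) = C_N = 0. *)
Definition sw_ansatz C (x v t : R) : R :=
  \sum_(n < N) C n x t * sw_hermite n ((v - u) / alpha).

(* Projected equations.  C expands the unknown w of the Vlasov equation, where
   w = f in the SW formulation and w = sqrt f in the SW square-root
   formulation.  The two unknowns satisfy the same equation (vlasov_sqrt), so
   both formulations lead to these equations for their coefficients C. *)
Definition sw_discretization C : Prop :=
  forall (x t : R) (k : 'I_N), 0 <= x <= ell -> J t ->
    \int[@lebesgue_measure R]_(xi in setT)
      (vlasov (sw_ansatz C) x (alpha * xi + u) t * sw_hermite k xi) = 0.

Definition Gplus (g : R -> R -> R) (x t : R) : R :=
  q / (m * alpha) * E x t * g x t + alpha * dx g x t.

Definition Gminus (g : R -> R -> R) (x t : R) : R :=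
  q / (m * alpha) * E x t * g x t - alpha * dx g x t.

Definition Av_entry (n k : 'I_N) (g : R -> R -> R) (x t : R) : R :=
  if k == n :> nat then - u * dx g x t
  else if k == n.+1 :> nat then - Num.sqrt (n.+1%:R / 2) * Gplus g x t
  else if k.+1 == n :> nat then Num.sqrt (n%:R / 2) * Gminus g x t
  else 0.

Definition Av C (n : 'I_N) (x t : R) : R :=
  \sum_(k < N) Av_entry n k (C k) x t.

End Vlasov.

Section SquareRoot.
Context {R : realType}.

Lemma within_dnbhs_proper (D : set R) (x y : R) :
  is_interval D -> D x -> D y -> y != x -> ProperFilter (within D x^').
Proof.
move=> iD Dx Dy yx; apply: Build_ProperFilter_ex => P.
move=> /nbhs_ballP[e /= e0 He].
have yx0 : y - x != 0 by rewrite subr_eq0.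
have d0 : 0 < `|y - x| by rewrite normr_gt0.
set l := Num.min 1 (e / (2 * `|y - x|)).
have l0 : 0 < l by rewrite lt_min ltr01 /= divr_gt0// mulr_gt0.
have l1 : l <= 1 by rewrite ge_min lexx.
have le : l * `|y - x| < e.
  have : l <= e / (2 * `|y - x|) by rewrite ge_min lexx orbT.
  rewrite ler_pdivlMr ?mulr_gt0// => h.
  have : 0 < l * `|y - x| by rewrite mulr_gt0.
  by move: h; rewrite mulrCA; lra.
exists (x + l * (y - x)); apply: He => /=.
- by rewrite /ball/= opprD addNKr normrN normrM (gtr0_norm l0).
- apply/eqP => /(congr1 (fun z => z - x)); rewrite subrr addrAC subrr add0r.
  by move=> /eqP; rewrite mulf_eq0 (negPf yx0) orbF gt_eqF.
- case: (ltgtP y x) (yx) => // [yltx|xlty] _.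
  + apply: (iD y x) => //; apply/andP; split; nra.
  + apply: (iD x y) => //; apply/andP; split; nra.
Qed.

Lemma derive_in_sqrt (D : set R) (f : R -> R) (x : R) :
  ProperFilter (within D x^') -> 0 < f x -> derivable_in D f x ->
  derive_in D (fun y => Num.sqrt (f y)) x
  = derive_in D f x / (2 * Num.sqrt (f x)).
Proof.
move=> pF fx0 df; set F := within D x^'.
have idF : (y - x) @[y --> F] --> 0.
  rewrite -(subrr x); apply: cvgB; last exact: cvg_cst.
  by do 2![apply: cvg_within_filter]; exact: cvg_id.
have nF : \forall y \near F, y != x.
  have h : F [set y | y != x] by apply: filterS (nbhs_dnbhs_neq x) => y.
  exact: h.
have ff : f y @[y --> F] --> f x.
  have h : (f x + diff_quotient f x y * (y - x)) @[y --> F] --> f x.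
    rewrite -[X in _ --> X]addr0 -(mulr0 (derive_in D f x)).
    by apply: cvgD; [exact: cvg_cst|exact: cvgM].
  apply: cvg_trans h; apply: near_eq_cvg.
  apply: filterS nF => y yx; rewrite /diff_quotient divfK ?subr_eq0//.
  by rewrite addrC subrK.
have sf : Num.sqrt (f y) @[y --> F] --> Num.sqrt (f x).
  exact: (continuous_cvg _ (@sqrt_continuous R (f x)) ff).
have s0 : 0 < Num.sqrt (f x) by rewrite sqrtr_gt0.
apply: cvg_lim => //.
have h : (diff_quotient f x y / (Num.sqrt (f y) + Num.sqrt (f x))) @[y --> F]
         --> derive_in D f x / (2 * Num.sqrt (f x)).
  apply: cvgM => //; apply: cvgV; first by rewrite mulf_neq0// gt_eqF.
  rewrite mulr_natl mulr2n; apply: cvgD => //; exact: cvg_cst.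
apply: cvg_trans h; apply: near_eq_cvg.
have fpos : \forall y \near F, 0 < f y by exact: (cvgr_gt _ ff).
near=> y.
have fy0 : 0 < f y by near: y.
have yx : y - x != 0 by rewrite subr_eq0; near: y.
have sy : 0 < Num.sqrt (f y) by rewrite sqrtr_gt0.
have n0 : Num.sqrt (f y) + Num.sqrt (f x) != 0 by rewrite gt_eqF ?addr_gt0.
rewrite /diff_quotient -[X in (X - _) / _ / _]sqr_sqrtr ?ltW//.
rewrite -[X in (_ - X) / _ / _](@sqr_sqrtr _ (f x)) ?ltW// subr_sqr.
by rewrite mulrAC mulfK.
Unshelve. all: by end_near. Qed.

Lemma vlasov_sqrt (ell : R) (J : set R) (q m : R) (E : R -> R -> R)
    (w : R -> R -> R -> R) (x v t : R) :
  0 < ell -> is_interval J -> (exists s t, [/\ J s, J t & s < t]) ->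
  0 <= x <= ell -> J t -> 0 < w x v t ->
  derivable_in `[0, ell] (fun y => w y v t) x ->
  derivable_in J (fun s => w x v s) t ->
  derivable (fun z => w x z t) v 1 ->
  vlasov ell J q m E (fun y z s => Num.sqrt (w y z s)) x v t
  = vlasov ell J q m E w x v t / (2 * Num.sqrt (w x v t)).
Proof.
move=> l0 iJ [s1 [s2 [J1 J2 s12]]] xl Jt w0 dwx dwt dwv.
have pJ : ProperFilter (within J t^').
  have [e|n] := eqVneq s1 t.
    by apply: (@within_dnbhs_proper _ _ s2) => //; rewrite -e gt_eqF.
  exact: (@within_dnbhs_proper _ _ s1).
have pX : ProperFilter (within `[0, ell] x^').
  have iI : is_interval `[0, ell]%classic by exact: interval_is_interval.
  have [e|n] := eqVneq 0 x.
    apply: (@within_dnbhs_proper _ _ ell) => //; rewrite -?e ?gt_eqF//=;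
      by rewrite in_itv/= lexx ltW.
  by apply: (@within_dnbhs_proper _ _ 0) => //=; rewrite in_itv/= lexx ltW.
rewrite /vlasov /dt /dx !derive_in_sqrt//.
have -> : derive1 (fun z => Num.sqrt (w x z t)) v
  = derive1 (fun z => w x z t) v / (2 * Num.sqrt (w x v t)).
  rewrite (_ : (fun z => _) = Num.sqrt \o (fun z => w x z t))//.
  have [ds _] := is_derive1_sqrt w0.
  rewrite derive1_comp//.
  by rewrite [X in X * _]derive1E derive_sqrt// mulrC.
by rewrite !mulrDl !mulrA.
Qed.

End SquareRoot.

(* Main.v *)
Require Import Defs.
From mathcomp Require Import measurable_realfun normal_distribution.
From mathcomp Require Import ring lra.

(** The evolution equations come from orthonormality, and the antisymmetry
from an antisymmetric arrangement of the coefficients of those equations.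

Write [psi_n = p_n e^(-x^2/2)], where [p_n] is the normalized Hermite polynomial
[sw_poly n].  Every integral in the projected equations is then of the form
[L(p) = int p(x) e^(-x^2) dx] for a polynomial [p] (the functional
[gauss_moment]).  The integral of the derivative of [p e^(-x^2)] over the line is
zero, so [L(p' - 2 X p) = 0] ([gauss_moment_total_derivative]).  As
[H_(n+1) = 2 X H_n - H_n'], this says [L(H_(n+1) q) = L(H_n q')]: a Hermite factor
is traded for a derivative.  Together with [H_n' = 2 n H_(n-1)] and
[L(1) = sqrt pi] it yields [L(p_n p_k) = delta_nk], and the matrices of
multiplication by [xi] and of [d/dxi] in the basis [psi_n]:
[xi psi_n = sqrt((n+1)/2) psi_(n+1) + sqrt(n/2) psi_(n-1)] and
[psi_n' = - sqrt((n+1)/2) psi_(n+1) + sqrt(n/2) psi_(n-1)].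

At fixed [(x, t)] the Vlasov operator applied to the ansatz is, as a function of
[xi], a polynomial times [e^(-xi^2/2)] ([vlasov_ansatzE]): [v] becomes
[alpha xi + u] and [d/dv] becomes [alpha^-1 d/dxi].  Its projection on [psi_k] is
therefore read off those two matrices and equals [dt C_k - (A_v C)_k]
([projected_equation]); the discretization says that it vanishes.

For the antisymmetry, each entry of [A_v] is [a_nk E + b_nk d/dx], where the matrix
[a] is antisymmetric and [b] is symmetric.  In
[<A_v Phi, Theta> + <Phi, A_v Theta>] the [E] terms cancel in pairs, and the
derivative terms combine to multiples of the integral of
[d/dx (Phi_k Theta_n)] over [[0, ell]], which is zero by periodicity
([integral_derivM]).  Splitting the integrals is legitimate because [E Phi_k] is
integrable as a product of two square-integrable functions, and [Theta_n] is
bounded. *)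

Local Open Scope classical_set_scope.
Local Open Scope ring_scope.

(** * Moments of the Gaussian weight *)

Section GaussMoment.
Context {R : realType}.
Notation mu := (@lebesgue_measure R).
Implicit Types (p q : {poly R}) (x : R).

Lemma monomial_le_expR n x :
  `|x| ^+ n <= (1 + 2 ^+ n * n`!%:R) * expR (x ^+ 2 / 2).
Proof.
set y := x ^+ 2 / 2.
have y0 : 0 <= y by rewrite divr_ge0// sqr_ge0.
have e1 : 1 <= expR y by rewrite -expR0 ler_expR.
have h1 : `|x| ^+ n <= 1 + (x ^+ 2) ^+ n.
  rewrite -real_normK ?num_real// -exprM mulnC exprM.
  have : 0 <= `|x| ^+ n by rewrite exprn_ge0.
  by move: (`|x| ^+ n) => z; nra.
(* With y = x^2 / 2, one term of the exponential series gives y^n / n! <= e^y. *)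
have h2 : (x ^+ 2) ^+ n <= 2 ^+ n * n`!%:R * expR y.
  have -> : x ^+ 2 = 2 * y by rewrite /y mulrC divfK.
  rewrite exprMn -mulrA ler_wpM2l ?exprn_ge0//.
  rewrite -ler_pdivrMl ?ltr0n ?fact_gt0// mulrC.
  case: n {h1} => [|n]; first by rewrite expr0 divr1.
  by apply: le_trans (expR_ge1Dxn n y0); rewrite lerDr.
rewrite mulrDl mul1r; apply: (le_trans h1).
exact: lerD.
Qed.

(** The Gaussian weight is the square of [e^(-x^2/2)]: this bound lets one factor
absorb the polynomial, and the other factor is left to give integrability and
decay. *)
Lemma poly_le_expR p : exists K, forall x, `|p.[x]| <= K * expR (x ^+ 2 / 2).
Proof.
exists (\sum_(i < size p) `|p`_i| * (1 + 2 ^+ i * i`!%:R)) => x.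
rewrite horner_coef (le_trans (ler_norm_sum _ _ _))// mulr_suml ler_sum// => i _.
by rewrite normrM normrX -mulrA ler_wpM2l// monomial_le_expR.
Qed.

Lemma gauss_funE x :
  gauss_fun x = expR (- (x ^+ 2 / 2)) * expR (- (x ^+ 2 / 2)).
Proof. by rewrite -expRD /gauss_fun; congr expR; lra. Qed.

Lemma poly_gauss_le p :
  exists K, forall x, `|p.[x] * gauss_fun x| <= K * expR (- (x ^+ 2 / 2)).
Proof.
have [K hK] := poly_le_expR p; exists K => x.
rewrite gauss_funE mulrA normrM (ger0_norm (expR_ge0 _)) ler_wpM2r ?expR_ge0//.
rewrite normrM (ger0_norm (expR_ge0 _)) expRN ler_pdivrMr ?expR_gt0//.
Qed.

(** This is the standard normal density up to its normalization. *)
Lemma integrable_half_gauss :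
  mu.-integrable setT (EFin \o (fun x : R => expR (- (x ^+ 2 / 2)))).
Proof.
have p0 : @normal_peak R 1 != 0.
  by rewrite gt_eqF// normal_peak_gt0// oner_neq0.
have := integrableZl measurableT (@normal_peak R 1)^-1
  (@integrable_normal_pdf R 0 1).
apply: eq_integrable => // x _.
rewrite normal_pdfE ?oner_neq0// /normal_fun /= -EFinM mulKf//.
by rewrite subr0 expr1n mulNr.
Qed.

Lemma measurable_poly_gauss p :
  measurable_fun setT (fun x => p.[x] * gauss_fun x).
Proof.
apply: measurable_funM; last exact: measurable_gauss_fun.
apply: continuous_measurable_fun => x.
exact/differentiable_continuous/derivable1_diffP/derivable_horner.
Qed.

Lemma integrable_poly_gauss p :
  mu.-integrable setT (EFin \o (fun x => p.[x] * gauss_fun x)).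
Proof.
have [K hK] := poly_gauss_le p.
apply: le_integrable (integrableZl measurableT K integrable_half_gauss) => //.
  by apply/measurable_EFinP; exact: measurable_poly_gauss.
by move=> x _ /=; rewrite lee_fin (le_trans (hK x))// ler_norm.
Qed.

(** The functional [L] to which all velocity integrals reduce. *)
Definition gauss_moment p : R := \int[mu]_(x in setT) (p.[x] * gauss_fun x).

Lemma gauss_momentD p q : gauss_moment (p + q) = gauss_moment p + gauss_moment q.
Proof.
rewrite /gauss_moment -RintegralD//; [|exact: integrable_poly_gauss..].
by apply: eq_Rintegral => x _; rewrite hornerD mulrDl.
Qed.

Lemma gauss_momentZ a p : gauss_moment (a *: p) = a * gauss_moment p.
Proof.
rewrite /gauss_moment -RintegralZl//; last exact: integrable_poly_gauss.
by apply: eq_Rintegral => x _; rewrite hornerZ mulrA.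
Qed.

Lemma gauss_moment0 : gauss_moment 0 = 0.
Proof. by rewrite -(scale0r 0) gauss_momentZ mul0r. Qed.

Lemma gauss_moment_sum n (F : 'I_n -> {poly R}) :
  gauss_moment (\sum_(i < n) F i) = \sum_(i < n) gauss_moment (F i).
Proof. exact: (big_morph _ gauss_momentD gauss_moment0). Qed.

Lemma gauss_moment1 : gauss_moment 1 = Num.sqrt pi.
Proof.
rewrite /gauss_moment /Rintegral -[RHS]/(fine (Num.sqrt pi)%:E) -integralT_gauss.
by congr fine; apply: eq_integral => x _; rewrite hornerE mul1r.
Qed.

Lemma is_derive_poly_gauss p x :
  is_derive x 1 (fun y => p.[y] * gauss_fun y)
    ((p^`() - 2%:R *: ('X * p)).[x] * gauss_fun x).
Proof.
have dg : is_derive x 1 (@gauss_fun R) (- (2 * x) * gauss_fun x).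
  rewrite /gauss_fun.
  have d : is_derive x 1 (fun y : R => - y ^+ 2) (- (2 * x)).
    apply: is_derive_eq.
    by rewrite [x%:A]mulr1 mulr_natl mulr2n.
  have := @is_derive1_comp _ (@expR R) (fun y : R => - y ^+ 2) x _ _
    (is_derive_expR _) d.
  move=> h; apply: (@is_derive_eq _ _ _ _ _ _ _ _ h).
  by rewrite mulrC.
have := @is_deriveM _ _ (horner p) (@gauss_fun R) x 1 _ _ (is_derive_poly p x) dg.
move=> h; apply: (@is_derive_eq _ _ _ _ _ _ _ _ h).
rewrite !hornerE /= /GRing.scale/=; ring.
Qed.

Lemma cvg_half_gauss : expR (- (n%:R ^+ 2 / 2)) @[n --> \oo] --> (0 : R).
Proof.
apply: (@squeeze_cvgr _ _ _ _ (cst 0) (fun n => 2 * (@harmonic R) n)).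
- apply: nearW => n /=; rewrite expR_ge0/= /harmonic.
  rewrite expRN ler_pdivlMr ?ltr0n// mulrC ler_pdivrMr ?expR_gt0//.
  have : 1 + n%:R ^+ 2 / 2 <= expR (n%:R ^+ 2 / 2 : R) by exact: expR_ge1Dx.
  have : 0 <= (n%:R : R) by [].
  by rewrite -(natr1 n); nra.
- exact: cvg_cst.
- rewrite -[X in _ --> X](mulr0 2); apply: cvgM; first exact: cvg_cst.
  exact: cvg_harmonic.
Qed.

Lemma poly_gauss_cvg0 p (s : R) : s ^+ 2 = 1 ->
  p.[s * n%:R] * gauss_fun (s * n%:R) @[n --> \oo] --> (0 : R).
Proof.
move=> s1; have [K hK] := poly_gauss_le p.
apply/norm_cvg0P.
apply: (@squeeze_cvgr _ _ _ _ (cst 0) (fun n => K * expR (- (n%:R ^+ 2 / 2)))).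
- apply: nearW => n /=; rewrite normr_ge0/= (le_trans (hK _))//.
  by rewrite exprMn s1 mul1r.
- exact: cvg_cst.
- rewrite -[X in _ --> X](mulr0 K); apply: cvgM; first exact: cvg_cst.
  exact: cvg_half_gauss.
Qed.

(** The argument of [L], times the weight, is the derivative of
[p e^(-x^2)].  The fundamental theorem of calculus on [[-n, n]] gives boundary
values that tend to zero, and dominated convergence lets [n] go to infinity. *)
Lemma gauss_moment_total_derivative p :
  gauss_moment (p^`() - 2%:R *: ('X * p)) = 0.
Proof.
set q := p^`() - _.
pose F x := p.[x] * gauss_fun x; pose f x := q.[x] * gauss_fun x.
pose D n := `[- (n.+1%:R : R), n.+1%:R]%classic.
(* The bounds are n + 1 rather than n so that the interval is nondegenerate. *)
have D_int n : (\int[mu]_(x in D n) (f x)%:E = (F n.+1%:R - F (- n.+1%:R))%:E)%E.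
  rewrite /D (@continuous_FTC2 _ f F) ?gtrN ?ltr0n//.
  - apply: continuous_subspaceT => x.
    apply: (@differentiable_continuous); apply/derivable1_diffP.
    by have [] := is_derive_poly_gauss q x.
  - have cF x : F y @[y --> x] --> F x.
      apply: (@differentiable_continuous); apply/derivable1_diffP.
      by have [] := is_derive_poly_gauss p x.
    split; first by move=> x _; have [] := is_derive_poly_gauss p x.
    + exact/cvg_at_right_filter/cF.
    + exact/cvg_at_left_filter/cF.
  - by move=> x _; rewrite derive1E; have [] := is_derive_poly_gauss p x.
have F0 : (F n.+1%:R - F (- n.+1%:R)) @[n --> \oo] --> (0 : R).
  rewrite -[X in _ --> X](subrr 0); apply: cvgB.
    have := @poly_gauss_cvg0 p 1 (expr1n _ _).
    by under eq_fun do rewrite mul1r; rewrite -(cvg_shiftS).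
  have := @poly_gauss_cvg0 p (-1) (sqrr_sign _ 1).
  by under eq_fun do rewrite mulN1r; rewrite -(cvg_shiftS).
have fint := integrable_poly_gauss q.
have mD n : measurable (D n) by exact: measurable_itv.
have [|||||_ _] := @dominated_convergence _ _ _ mu setT measurableT
  (fun n => (EFin \o f) \_ (D n)) (EFin \o f) (fun x => `|(f x)%:E|%E).
- move=> n; apply/(measurable_restrictT _ (mD n)).
  apply: measurable_funTS; apply/measurable_EFinP.
  exact: measurable_poly_gauss.
- by apply/measurable_EFinP; exact: measurable_poly_gauss.
- apply: aeW => x _; apply: cvg_near_cst.
  exists (Num.truncn `|x|) => //= n /= xn; rewrite patchE mem_set//.
  rewrite /D/= in_itv/= -ler_norml (le_trans (ltW (truncnS_gt _)))//.
  by rewrite ler_nat ltnS.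
- exact: integrable_abse.
- apply: aeW => x n _; rewrite patchE; case: ifPn => // _.
  by rewrite abse0 abse_ge0.
move=> h; rewrite /gauss_moment /Rintegral -[X in X = _]/(fine _).
suff -> : (\int[mu]_(x in setT) (f x)%:E = 0)%E by [].
apply: (cvg_unique _ h); first exact: ereal_hausdorff.
rewrite (_ : (fun n => _) = (fun n => (F n.+1%:R - F (- n.+1%:R))%:E)).
  by apply: cvg_EFin; [exact: nearW|exact: F0].
by apply/funext => n; rewrite -D_int -integral_mkcond.
Qed.

End GaussMoment.

(** * Hermite functions *)

Section HermitePolynomials.
Context {R : realType}.
Implicit Types (p q : {poly R}) (x : R) (n k : nat).

Lemma hermiteS n : hermite n.+1 = 2%:R *: ('X * hermite n) - (hermite n)^`() :> {poly R}.
Proof. by []. Qed.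

(** Integration by parts: the difference of the two arguments is minus a total
derivative. *)
Lemma gauss_moment_hermiteS n q :
  gauss_moment (hermite n.+1 * q) = gauss_moment (hermite n * q^`()).
Proof.
have -> : hermite n.+1 * q = hermite n * q^`()
    + -1 *: ((hermite n * q)^`() - 2%:R *: ('X * (hermite n * q))).
  rewrite hermiteS derivM scaleN1r -!mul_polyC; ring.
by rewrite gauss_momentD gauss_momentZ gauss_moment_total_derivative mulr0 addr0.
Qed.

Lemma deriv_hermite0 : (hermite 0)^`() = 0 :> {poly R}.
Proof. by rewrite /= -polyC1 derivC. Qed.

(** The recurrence expresses [H_n'] through [2 X H_n - H_(n+1)], which turns the
second derivative arising in the induction into known terms. *)
Lemma deriv_hermiteS n : (hermite n.+1)^`() = (2 * n.+1)%:R *: hermite n :> {poly R}.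
Proof.
elim: n => [|n IHn].
  rewrite hermiteS deriv_hermite0 subr0 derivZ derivM derivX deriv_hermite0.
  by rewrite mulr0 mul1r addr0 muln1.
rewrite hermiteS derivB derivZ derivM derivX IHn derivZ mul1r.
have -> : (hermite n)^`() = 2%:R *: ('X * hermite n) - hermite n.+1 :> {poly R}.
  by rewrite hermiteS subKr.
rewrite -!mul_polyC !polyC_natr; ring.
Qed.

Lemma deriv_hermite n : (hermite n)^`() = (2 * n)%:R *: hermite n.-1 :> {poly R}.
Proof.
case: n => [|n]; last exact: deriv_hermiteS.
by rewrite muln0 scale0r deriv_hermite0.
Qed.

(** Integration by parts lowers both indices by one; when one of them is zero
before the other, the derivative of the constant [H_0] makes the integral
vanish. *)
Lemma hermite_orthogonal n k :
  gauss_moment (hermite n * hermite k)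
  = (n == k)%:R * (Num.sqrt pi * 2 ^+ n * n`!%:R) :> R.
Proof.
elim: n k => [|n IHn] [|k].
- by rewrite mulr1 gauss_moment1 eqxx mul1r expr0 !mulr1.
- by rewrite mulrC gauss_moment_hermiteS deriv_hermite0 mulr0
    gauss_moment0 mul0r.
- by rewrite gauss_moment_hermiteS deriv_hermite0 mulr0
    gauss_moment0 mul0r.
- rewrite gauss_moment_hermiteS deriv_hermiteS -scalerAr gauss_momentZ IHn eqSS.
  have [<-|_] := eqVneq n k; last by rewrite !mul0r mulr0.
  by rewrite !mul1r factS exprS !natrM; ring.
Qed.

Definition hermite_norm n : R := Num.sqrt (Num.sqrt pi * 2 ^+ n * n`!%:R).

Lemma hermite_norm_gt0 n : 0 < hermite_norm n.
Proof.
by rewrite sqrtr_gt0 !mulr_gt0// ?sqrtr_gt0 ?pi_gt0 ?exprn_gt0// ltr0n fact_gt0.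
Qed.

Lemma hermite_normS n :
  hermite_norm n.+1 = 2 * Num.sqrt (n.+1%:R / 2) * hermite_norm n.
Proof.
have e : 2 = Num.sqrt (2 ^+ 2) :> R by rewrite sqrtr_sqr ger0_norm.
rewrite {1}e /hermite_norm -!sqrtrM ?mulr_ge0// ?sqr_ge0//; congr Num.sqrt.
by rewrite exprS factS natrM; field.
Qed.

Definition sw_poly n : {poly R} := (hermite_norm n)^-1 *: hermite n.

Lemma sw_hermiteE n x : sw_hermite n x = (sw_poly n).[x] * expR (- (x ^+ 2 / 2)).
Proof. by rewrite hornerZ. Qed.

Lemma sw_poly_orthonormal n k : gauss_moment (sw_poly n * sw_poly k) = (n == k)%:R.
Proof.
rewrite -scalerAl -scalerAr !gauss_momentZ hermite_orthogonal.
have [<-|_] := eqVneq n k; last by rewrite mul0r !mulr0.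
have <- : hermite_norm n ^+ 2 = Num.sqrt pi * 2 ^+ n * n`!%:R.
  by rewrite sqr_sqrtr// !mulr_ge0// ?sqrtr_ge0// exprn_ge0.
by field; rewrite gt_eqF ?hermite_norm_gt0.
Qed.

(** For [n = 0] the predecessor is truncated, but its factor [sqrt (n / 2)] is
zero. *)
Lemma deriv_sw_poly n :
  (sw_poly n)^`() = (2 * Num.sqrt (n%:R / 2)) *: sw_poly n.-1.
Proof.
rewrite derivZ deriv_hermite !scalerA; case: n => [|n].
  by rewrite muln0 mulr0 mul0r sqrtr0 mulr0 mul0r.
congr (_ *: _); rewrite hermite_normS natrM /=.
have h := hermite_norm_gt0 n.
have s : 0 < Num.sqrt (n.+1%:R / 2) :> R by rewrite sqrtr_gt0 divr_gt0.
have : n.+1%:R = 2 * Num.sqrt (n.+1%:R / 2) ^+ 2 :> R.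
  by rewrite sqr_sqrtr ?divr_ge0// mulrC divfK.
move: s h; move: (Num.sqrt _) (hermite_norm _) => s h s0 h0 ->.
by field; rewrite !gt_eqF.
Qed.

(** The recurrence, solved for [X H_n], gives the neighbour [H_(n+1)] and half the
derivative [H_n'], which is the neighbour [H_(n-1)]. *)
Lemma mulX_sw_poly n :
  'X * sw_poly n = Num.sqrt (n.+1%:R / 2) *: sw_poly n.+1
                   + Num.sqrt (n%:R / 2) *: sw_poly n.-1.
Proof.
have -> : sw_poly n.+1 = (Num.sqrt (n.+1%:R / 2))^-1 *:
    ('X * sw_poly n - 2^-1 *: (sw_poly n)^`()).
  rewrite /sw_poly hermiteS hermite_normS derivZ -scalerAr.
  rewrite !(scalerBr, scalerA) !invfM; congr (_ *: _ - _ *: _).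
    by field; rewrite gt_eqF ?hermite_norm_gt0// gt_eqF// sqrtr_gt0 divr_gt0.
  by field; rewrite gt_eqF ?hermite_norm_gt0// gt_eqF// sqrtr_gt0 divr_gt0.
rewrite scalerA divff ?scale1r; last by rewrite gt_eqF// sqrtr_gt0 divr_gt0.
by rewrite deriv_sw_poly scalerA mulKf// subrK.
Qed.

(** Differentiating the weight [e^(-x^2/2)] subtracts [X p_n] from [p_n']. *)
Lemma is_derive_sw_hermite n x :
  is_derive x 1 (sw_hermite n)
    (((sw_poly n)^`() - 'X * sw_poly n).[x] * expR (- (x ^+ 2 / 2))).
Proof.
have -> : sw_hermite n = fun y => (sw_poly n).[y] * expR (- (y ^+ 2 / 2)).
  by apply/funext => y; exact: sw_hermiteE.
have dg : is_derive x 1 (fun y : R => expR (- (y ^+ 2 / 2)))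
    (- x * expR (- (x ^+ 2 / 2))).
  have d : is_derive x 1 (fun y : R => - (y ^+ 2 / 2)) (- x).
    apply: is_derive_eq.
    by rewrite /GRing.scale/=; field.
  have := @is_derive1_comp _ (@expR R) (fun y : R => - (y ^+ 2 / 2)) x _ _
    (is_derive_expR _) d.
  move=> h; apply: (@is_derive_eq _ _ _ _ _ _ _ _ h).
  by rewrite mulrC.
have := @is_deriveM _ _ (horner (sw_poly n)) _ x 1 _ _ (is_derive_poly _ x) dg.
move=> h; apply: (@is_derive_eq _ _ _ _ _ _ _ _ h).
rewrite !hornerE /= /GRing.scale/=; ring.
Qed.

(** The matrix of multiplication by [xi] in the basis [psi_n]. *)
Lemma gauss_moment_mulX n k : gauss_moment ('X * sw_poly n * sw_poly k)
  = Num.sqrt (n.+1%:R / 2) * (n.+1 == k)%:R + Num.sqrt (n%:R / 2) * (n == k.+1)%:R.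
Proof.
rewrite mulX_sw_poly mulrDl -!(scalerAl (Num.sqrt _)).
rewrite gauss_momentD !gauss_momentZ !sw_poly_orthonormal.
by case: n => [|n]//=; rewrite mul0r sqrtr0 !mul0r.
Qed.

(** The matrix of [d/dxi] in the basis [psi_n]. *)
Lemma gauss_moment_deriv n k :
  gauss_moment (((sw_poly n)^`() - 'X * sw_poly n) * sw_poly k)
  = - Num.sqrt (n.+1%:R / 2) * (n.+1 == k)%:R + Num.sqrt (n%:R / 2) * (n == k.+1)%:R.
Proof.
rewrite mulrBl gauss_momentD -[- (_ * _)]scaleN1r gauss_momentZ gauss_moment_mulX.
rewrite deriv_sw_poly -scalerAl gauss_momentZ sw_poly_orthonormal.
case: n => [|n]/=; first by rewrite mul0r sqrtr0; ring.
rewrite eqSS; ring.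
Qed.

End HermitePolynomials.

(** * Derivatives relative to a set *)

Section DerivIn.
Context {R : realType}.

Lemma within_dnbhs_nontrivial (D : set R) (x : R) :
  is_interval D -> (exists s t, [/\ D s, D t & s < t]) -> D x ->
  ProperFilter (within D x^').
Proof.
move=> iD [s [t [Ds Dt st]]] Dx; have [e|n] := eqVneq s x.
  by apply: (@within_dnbhs_proper _ _ _ t) => //; rewrite -e gt_eqF.
exact: (@within_dnbhs_proper _ _ _ s).
Qed.

Lemma derive_in_sum (D : set R) (x : R) N (f : 'I_N -> R -> R) (c : 'I_N -> R) :
  ProperFilter (within D x^') -> (forall i, derivable_in D (f i) x) ->
  derive_in D (fun y => \sum_(i < N) f i y * c i) x
  = \sum_(i < N) derive_in D (f i) x * c i.
Proof.
move=> pF df; apply: cvg_lim => //.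
rewrite (_ : diff_quotient _ _ =
    fun y => \sum_(i < N) diff_quotient (f i) x y * c i); last first.
  apply/funext => y; rewrite /diff_quotient -sumrB mulr_suml.
  by apply: eq_bigr => i _; rewrite -mulrBl mulrAC.
apply: cvg_big => [|i _]; first exact: add_continuous.
by apply: cvgM; [exact: df|exact: cvg_cst].
Qed.

End DerivIn.

(** * Projection of the Vlasov equation *)

Section Projection.
Context {R : realType}.
Variables (ell : R) (J : set R) (q m u alpha : R) (N : nat) (E : R -> R -> R).
Hypotheses (ell_gt0 : 0 < ell) (J_itv : is_interval J)
  (J_nontrivial : exists s t, [/\ J s, J t & s < t]).
Hypotheses (alpha_gt0 : 0 < alpha).
Variable C : 'I_N -> R -> R -> R.
Hypothesis C_derivable : forall (n : 'I_N) (x t : R), 0 <= x <= ell -> J t ->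
        derivable_in `[0, ell] (fun y => C n y t) x /\
        derivable_in J (fun s => C n x s) t.

(** The polynomial factor of the Vlasov operator applied to the ansatz, in the
variable [xi = (v - u) / alpha]. *)
Definition vlasov_poly x t : {poly R} :=
  \sum_(n < N) (dt J (C n) x t *: sw_poly n
    + dx ell (C n) x t *: (alpha *: ('X * sw_poly n) + u *: sw_poly n)
    + (q / m * E x t * C n x t / alpha)
      *: ((sw_poly n)^`() - 'X * sw_poly n)).

Lemma derive1_sw_ansatz x t xi :
  derive1 (fun z => sw_ansatz u alpha C x z t) (alpha * xi + u)
  = \sum_(n < N) C n x t / alpha *
     (((sw_poly n)^`() - 'X * sw_poly n).[xi] * expR (- (xi ^+ 2 / 2))).
Proof.
rewrite derive1E /sw_ansatz.
have d (n : 'I_N) : is_derive (alpha * xi + u) 1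
    (fun z => C n x t * sw_hermite n ((z - u) / alpha))
    (C n x t / alpha *
     (((sw_poly n)^`() - 'X * sw_poly n).[xi] * expR (- (xi ^+ 2 / 2)))).
  set z0 := alpha * xi + u.
  have d0 : is_derive z0 1 (fun z : R => (z - u) / alpha) alpha^-1.
    apply: is_derive_eq.
    by rewrite /GRing.scale/=; field; rewrite gt_eqF.
  have e : (z0 - u) / alpha = xi by rewrite /z0 addrK mulrAC divff ?gt_eqF ?mul1r.
  have := @is_derive1_comp _ (sw_hermite n) _ z0 _ _ (is_derive_sw_hermite n _) d0.
  rewrite e => h.
  have := @is_deriveZ _ _ _ _ (C n x t) _ _ _ h.
  move=> h'; apply: (@is_derive_eq _ _ _ _ _ _ _ _ h').
  by rewrite /GRing.scale/=; ring.
have := @is_derive_sum _ _ _ _ _ _ _ _ d.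
rewrite [X in is_derive _ _ X](_ : _ =
    fun z => \sum_(n < N) C n x t * sw_hermite n ((z - u) / alpha)).
  by case.
by apply/funext => z; rewrite fct_sumE.
Qed.

Lemma vlasov_ansatzE x t xi : 0 <= x <= ell -> J t ->
  vlasov ell J q m E (sw_ansatz u alpha C) x (alpha * xi + u) t
  = (vlasov_poly x t).[xi] * expR (- (xi ^+ 2 / 2)).
Proof.
move=> xl Jt; rewrite /vlasov.
have e : (alpha * xi + u - u) / alpha = xi by rewrite addrK mulrAC divff ?gt_eqF ?mul1r.
have -> : dt J (fun y s => sw_ansatz u alpha C y (alpha * xi + u) s) x t
   = \sum_(n < N) dt J (C n) x t * sw_hermite n xi.
  have pJ : ProperFilter (within J t^') by exact: within_dnbhs_nontrivial.
  rewrite /dt /sw_ansatz e derive_in_sum//.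
  by move=> n; have [] := C_derivable n _ _ xl Jt.
have -> : dx ell (fun y s => sw_ansatz u alpha C y (alpha * xi + u) s) x t
   = \sum_(n < N) dx ell (C n) x t * sw_hermite n xi.
  have pX : ProperFilter (within `[0, ell] x^').
    apply: within_dnbhs_nontrivial => //; first exact: interval_is_interval.
    by exists 0, ell; split => //=; rewrite in_itv/= lexx ltW.
  rewrite /dx /sw_ansatz e derive_in_sum//.
  by move=> n; have [] := C_derivable n _ _ xl Jt.
rewrite derive1_sw_ansatz /vlasov_poly horner_sum mulr_suml !mulr_sumr -!big_split.
apply: eq_bigr => n _; rewrite sw_hermiteE /=.
rewrite !(hornerD, hornerN, hornerZ, hornerM, hornerX); ring.
Qed.

(** Both sides are sums over the modes [n] of the ansatz and agree term by term;
the terms with [n] other than [k - 1], [k], [k + 1] are zero on both sides. *)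
Lemma gauss_moment_vlasov_poly (k : 'I_N) x t :
  gauss_moment (vlasov_poly x t * sw_poly k)
  = dt J (C k) x t - Av ell q m E u alpha C k x t.
Proof.
rewrite /vlasov_poly mulr_suml gauss_moment_sum.
have -> : dt J (C k) x t = \sum_(n < N) dt J (C n) x t * (n == k)%:R.
  rewrite (bigD1 k)//= eqxx mulr1 big1 ?addr0// => n /negPf nk.
  by rewrite nk mulr0.
rewrite /Av -sumrB; apply: eq_bigr => n _.
have := @gauss_moment_mulX R n k; have := @gauss_moment_deriv R n k.
have := @sw_poly_orthonormal R n k; rewrite -val_eqE /= (eq_sym (n.+1)).
move: (@sw_poly R n) (@sw_poly R k) => p r Mpr Md MX.
have -> : q / m * E x t * C n x t / alpha = q / (m * alpha) * E x t * C n x t.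
  by rewrite invfM; ring.
rewrite /Av_entry /Gplus /Gminus (eq_sym (n.+1)).
move: (q / (m * alpha) * E x t * C n x t) => c.
rewrite !mulrDl -!scalerAl mulrDl -!scalerAl !(gauss_momentD, gauss_momentZ).
rewrite Mpr Md MX {Mpr Md MX}.
have [->|_] := eqVneq (n : nat) k.
  rewrite (ltn_eqF (ltnSn _)) /=; ring.
have [->|_] := eqVneq (n : nat) k.+1.
  rewrite (ltn_eqF (leqW (leqnn _))) /=; ring.
have [->|_] := eqVneq (k : nat) n.+1; rewrite /=; ring.
Qed.

Lemma projected_equation (k : 'I_N) x t : 0 <= x <= ell -> J t ->
   \int[@lebesgue_measure R]_(xi in setT)
      (vlasov ell J q m E (sw_ansatz u alpha C) x (alpha * xi + u) t * sw_hermite k xi)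
  = dt J (C k) x t - Av ell q m E u alpha C k x t.
Proof.
move=> xl Jt; rewrite -gauss_moment_vlasov_poly.
apply: eq_Rintegral => xi _.
by rewrite vlasov_ansatzE// sw_hermiteE hornerM gauss_funE; ring.
Qed.

End Projection.

(** * Continuously differentiable functions on a segment *)

Section C1Segment.
Context {R : realType}.
Notation mu := (@lebesgue_measure R).
Implicit Types (f g : R -> R) (a b x : R).

(** [f y = f x + q (y - x)] where the difference quotient [q] converges. *)
Lemma derivable_in_cvg (D : set R) f x : derivable_in D f x ->
  f y @[y --> within D x^'] --> f x.
Proof.
move=> df; have idF : (y - x) @[y --> within D x^'] --> 0.
  rewrite -(subrr x); apply: cvgB; last exact: cvg_cst.
  by do 2![apply: cvg_within_filter]; exact: cvg_id.
have h : (f x + diff_quotient f x y * (y - x)) @[y --> within D x^'] --> f x.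
  rewrite -[X in _ --> X]addr0 -(mulr0 (derive_in D f x)).
  by apply: cvgD; [exact: cvg_cst|exact: cvgM].
apply: cvg_trans h; apply: near_eq_cvg.
have nF : within D x^' [set y | y != x].
  by apply: filterS (nbhs_dnbhs_neq x) => y.
apply: filterS nF => y /= yx; rewrite /diff_quotient divfK ?subr_eq0//.
by rewrite addrC subrK.
Qed.

Lemma derivable_in_continuous (D : set R) f :
  (forall x, D x -> derivable_in D f x) -> {within D, continuous f}.
Proof.
move=> df; apply/subspace_continuousP => x Dx.
apply/cvgrPdist_lt => e e0.
have /cvgrPdist_lt/(_ e e0) := derivable_in_cvg _ _ _ (df x Dx).
rewrite !near_withinE => h.
near=> y => Dy; have [->|yx] := eqVneq y x; first by rewrite subrr normr0.
by move: yx Dy; near: y.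
Unshelve. all: by end_near. Qed.

Lemma shift_dnbhs_within (D : set R) x : nbhs x D ->
  h + x @[h --> 0^'] --> within D x^'.
Proof.
move=> Dx P P1; have P1x : nbhs x (fun y => y != x -> D y -> P y) := P1.
have : \forall y \near x, y != x -> P y.
  by apply: filterS2 P1x Dx => y h Dy yx; exact: h.
move=> /nbhs_ballP[e /= e0 He]; apply/nbhs_ballP; exists e => // h /= h0 hn.
apply: He; last by rewrite -subr_eq0 addrK.
by move: h0; rewrite /ball/= sub0r normrN opprD addrCA subrr addr0 normrN.
Qed.

(** At an interior point the constraint that the difference quotient stays in
[D] is void. *)
Lemma is_derive_derive_in (D : set R) f x : nbhs x D -> derivable_in D f x ->
  is_derive x 1 f (derive_in D f x).
Proof.
move=> Dx df.
have h : (fun h => h^-1 *: ((f \o shift x) (h *: 1) - f x)) @ 0^' -->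
    derive_in D f x.
  rewrite (_ : (fun h => _) = diff_quotient f x \o (fun h => h + x)).
    exact: cvg_comp (shift_dnbhs_within _ _ Dx) df.
  by apply/funext => h; rewrite /diff_quotient /= [h%:A]mulr1 addrK mulrC.
by apply: DeriveDef; [exact: (cvgP _ h)|exact: cvg_lim h].
Qed.

(** The regularity that the fundamental theorem of calculus asks for. *)
Lemma C1_in_derivable_oo a b f : a < b -> C1_in `[a, b] f ->
  derivable_oo_LRcontinuous f a b /\
  {in `]a, b[, f^`()%classic =1 derive_in `[a, b] f}.
Proof.
move=> ab [df _].
have dI x : x \in `]a, b[ -> is_derive x 1 f (derive_in `[a, b] f x).
  move=> xab; apply: is_derive_derive_in.
    apply: (filterS (@subset_itv_oo_cc _ _ a b)).
    by apply: near_in_itvoo.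
  by apply: df; exact: subset_itv_oo_cc.
split; last by move=> x /dI; rewrite derive1E => -[].
have /(continuous_within_itvP _ ab)[_ ? ?] := derivable_in_continuous _ _ df.
by split => // x /dI[].
Qed.

(** The two integrals add up to that of [(f g)'], hence to the increment of
[f g], and periodicity makes it vanish. *)
Lemma integral_derivM a b f g : a < b -> C1_in `[a, b] f -> C1_in `[a, b] g ->
  f a = f b -> g a = g b ->
  \int[mu]_(x in `[a, b]) (derive_in `[a, b] f x * g x)
  + \int[mu]_(x in `[a, b]) (f x * derive_in `[a, b] g x) = 0.
Proof.
move=> ab Cf Cg fab gab.
have [df Ef] := C1_in_derivable_oo _ _ _ ab Cf.
have [dg Eg] := C1_in_derivable_oo _ _ _ ab Cg.
rewrite [X in _ + X](@Rintegration_by_parts _ f g _ _ _ _ ab Cf.2 df Ef Cg.2 dg Eg).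
by rewrite fab gab subrr sub0r subrr.
Qed.

Lemma continuous_segment_bounded a b f : {within `[a, b], continuous f} ->
  [bounded f x | x in `[a, b]].
Proof.
move=> cf.
have /compact_bounded[M [Mr Mf]] := continuous_compact cf (@segment_compact _ a b).
exists M; split => // y My x xab.
exact: (Mf y My _ (imageP f xab)).
Qed.

Lemma L2_mul_integrable a b (f g : R -> R) :
  patch (fun=> 0) `[a, b] f \in Lfun mu 2%:E ->
  patch (fun=> 0) `[a, b] g \in Lfun mu 2%:E ->
  mu.-integrable `[a, b] (EFin \o (fun x => f x * g x)).
Proof.
move=> f2 g2; have /Lfun1_integrable := Lfun2_mul_Lfun1 f2 g2.
move=> h; apply/integrable_mkcond; first exact: measurable_itv.
apply: eq_integrable h => // x _.
by rewrite /= !patchE; case: ifPn; rewrite ?mul0r.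
Qed.

Lemma L2_mul_continuous_integrable a b (e f g : R -> R) :
  patch (fun=> 0) `[a, b] e \in Lfun mu 2%:E ->
  patch (fun=> 0) `[a, b] f \in Lfun mu 2%:E ->
  {within `[a, b], continuous g} ->
  mu.-integrable `[a, b] (EFin \o (fun x => e x * f x * g x)).
Proof.
move=> e2 f2 cg; apply: (integrableMl _ (L2_mul_integrable _ _ _ _ e2 f2)) => //.
- exact: subspace_continuous_measurable_fun.
- exact: continuous_segment_bounded.
Qed.

Lemma derive_in_mul_integrable a b f g :
  C1_in `[a, b] f -> C1_in `[a, b] g ->
  mu.-integrable `[a, b] (EFin \o (fun x => derive_in `[a, b] f x * g x)).
Proof.
move=> Cf Cg; apply: continuous_compact_integrable; first exact: segment_compact.
have /subspace_continuousP cf := Cf.2.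
have /subspace_continuousP cg := derivable_in_continuous _ _ Cg.1.
by apply/subspace_continuousP => x xab; apply: cvgM; [exact: cf|exact: cg].
Qed.

Lemma Rintegral_sum n (D : set R) (F : 'I_n -> R -> R) : measurable D ->
  (forall i, mu.-integrable D (EFin \o F i)) ->
  \int[mu]_(x in D) (\sum_(i < n) F i x)
  = \sum_(i < n) \int[mu]_(x in D) F i x.
Proof.
move=> mD iF; rewrite /Rintegral.
under eq_integral do rewrite -sumEFin.
rewrite integral_sum//.
by rewrite -sum_fine// => i _; apply: integrable_fin_num => //; exact: iF.
Qed.

End C1Segment.

(** * Antisymmetry of the discretized operator *)

Section Antisymmetry.
Context {R : realType}.
Variables (ell : R) (J : set R) (q m u alpha : R) (N : nat) (E : R -> R -> R).
Hypotheses (ell_gt0 : 0 < ell) (EW : inW ell J (fun _ : 'I_1 => E)).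
Notation mu := (@lebesgue_measure R).

(** The entries of the operator matrix are [field_coef n k * E + dx_coef n k * d/dx].
Separating the two coefficients exhibits the structure behind the antisymmetry:
the first is antisymmetric in [(n, k)] and multiplies a symmetric operator, the
second is symmetric and multiplies an antisymmetric one. *)
Definition field_coef (n k : 'I_N) : R :=
  q / (m * alpha) *
  (if k == n.+1 :> nat then - Num.sqrt (n.+1%:R / 2)
   else if k.+1 == n :> nat then Num.sqrt (n%:R / 2) else 0).

Definition dx_coef (n k : 'I_N) : R :=
  if k == n :> nat then - u
  else if k == n.+1 :> nat then - (Num.sqrt (n.+1%:R / 2) * alpha)
  else if k.+1 == n :> nat then - (Num.sqrt (n%:R / 2) * alpha) else 0.

Lemma Av_entryE (n k : 'I_N) g x t : Av_entry ell q m E u alpha n k g x t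
  = field_coef n k * (E x t * g x t) + dx_coef n k * dx ell g x t.
Proof.
rewrite /Av_entry /Gplus /Gminus /field_coef /dx_coef.
have [->|_] := eqVneq (k : nat) n.
  by rewrite (ltn_eqF (ltnSn _)) (gtn_eqF (ltnSn _)); ring.
by do 2![case: ifP => _; first by ring]; ring.
Qed.

Lemma field_coef_anti n k : field_coef k n = - field_coef n k.
Proof.
rewrite /field_coef.
have [->|_] := eqVneq (k : nat) n.+1.
  by rewrite (ltn_eqF (leqW (leqnn _))); ring.
by have [->|_] := eqVneq (n : nat) k.+1; ring.
Qed.

Lemma dx_coef_sym n k : dx_coef k n = dx_coef n k.
Proof.
rewrite /dx_coef.
have [//|_] := eqVneq (k : nat) n.
have [->|_] := eqVneq (k : nat) n.+1; first by rewrite (ltn_eqF (leqW (leqnn _))).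
by have [->|_] := eqVneq (n : nat) k.+1.
Qed.

Lemma integral_Av_entry (n k : 'I_N) (f g : R -> R -> R) t : J t ->
  inW ell J (fun _ : 'I_1 => f) -> C1_in `[0, ell] (fun x => f x t) ->
  C1_in `[0, ell] (fun x => g x t) ->
  mu.-integrable `[0, ell]
    (EFin \o (fun x => Av_entry ell q m E u alpha n k f x t * g x t))
  /\ \int[mu]_(x in `[0, ell]) (Av_entry ell q m E u alpha n k f x t * g x t)
  = field_coef n k * \int[mu]_(x in `[0, ell]) (E x t * f x t * g x t)
    + dx_coef n k * \int[mu]_(x in `[0, ell]) (dx ell f x t * g x t).
Proof.
move=> Jt fW fC gC.
have [E2 _] := EW ord0 t Jt; have [f2 _] := fW ord0 t Jt.
have mI : measurable (`[0, ell]%classic : set (measurableTypeR R)).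
  exact: measurable_itv.
have iE := L2_mul_continuous_integrable _ _ _ _ _ E2 f2
  (derivable_in_continuous _ _ gC.1).
have iD := derive_in_mul_integrable _ _ _ _ fC gC.
split.
  have := integrableD mI (integrableZl mI (field_coef n k) iE)
    (integrableZl mI (dx_coef n k) iD).
  apply: eq_integrable => // x _ /=.
  by rewrite Av_entryE -!EFinM -EFinD /dx; congr EFin; ring.
rewrite -!RintegralZl// -RintegralD//.
- by apply: eq_Rintegral => x _; rewrite Av_entryE; ring.
- exact: (integrableZl _ _ iE).
- exact: (integrableZl _ _ iD).
Qed.

Lemma inner_Av (f g : 'I_N -> R -> R -> R) t : J t ->
  inW ell J f -> C1_space ell J f -> C1_space ell J g ->
  inner ell (Av ell q m E u alpha f) g t
  = \sum_n \sum_k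
     (field_coef n k * \int[mu]_(x in `[0, ell]) (E x t * f k x t * g n x t)
      + dx_coef n k * \int[mu]_(x in `[0, ell]) (dx ell (f k) x t * g n x t)).
Proof.
move=> Jt fW fC gC; rewrite /inner; apply: eq_bigr => n _.
have fkW k : inW ell J (fun _ : 'I_1 => f k) by move=> _; exact: fW.
under eq_Rintegral => x _ do rewrite /Av mulr_suml.
have entry k := integral_Av_entry n k _ _ _ Jt (fkW k) (fC k t Jt) (gC n t Jt).
rewrite Rintegral_sum//; last by move=> k; exact: (entry k).1.
by apply: eq_bigr => k _; exact: (entry k).2.
Qed.

(** After an exchange of the indices in the second double sum, the terms of
indices [(n, k)] cancel. *)
Lemma Av_antisymmetric : antisymmetric_on ell J (@Av R ell q m E u alpha N).
Proof.
move=> f g fW gW fC gC t Jt.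
have -> : inner ell f (Av ell q m E u alpha g) t = inner ell (Av ell q m E u alpha g) f t.
  by apply: eq_bigr => n _; apply: eq_Rintegral => x _; exact: mulrC.
rewrite !inner_Av// [in RHS]exchange_big/=; apply/eqP; rewrite -addr_eq0 -big_split/=.
apply/eqP; apply: big1 => n _; rewrite -big_split/=; apply: big1 => k _.
rewrite field_coef_anti dx_coef_sym.
have -> : \int[mu]_(x in `[0, ell]) (E x t * g n x t * f k x t)
    = \int[mu]_(x in `[0, ell]) (E x t * f k x t * g n x t).
  by apply: eq_Rintegral => x _; ring.
have [_ f0] := fW k t Jt; have [_ g0] := gW n t Jt.
have := integral_derivM _ _ _ _ ell_gt0 (fC k t Jt) (gC n t Jt) f0 g0.
have -> : \int[mu]_(x in `[0, ell]) (dx ell (g n) x t * f k x t)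
    = \int[mu]_(x in `[0, ell]) (f k x t * dx ell (g n) x t).
  by apply: eq_Rintegral => x _; ring.
move=> /eqP; rewrite addr_eq0 => /eqP h.
by rewrite /dx h; ring.
Qed.

End Antisymmetry.

(** * Evolution of the coefficients and antisymmetry *)

Theorem theorem2 (R : realType) (ell : R) (J : set R) (q m u alpha : R)
    (N : nat) (E : R -> R -> R)
    (ell_gt0 : 0 < ell)
    (J_itv : is_interval J) (J_nontrivial : exists s t, [/\ J s, J t & s < t])
    (m_gt0 : 0 < m) (alpha_gt0 : 0 < alpha)
    (EW : inW ell J (fun _ : 'I_1 => E)) :
  (forall C : 'I_N -> R -> R -> R,
     inW ell J C ->
     (forall (n : 'I_N) (x t : R), 0 <= x <= ell -> J t ->
        derivable_in `[0, ell] (fun y => C n y t) x /\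
        derivable_in J (fun s => C n x s) t) ->
     sw_discretization ell J q m E u alpha C ->
     forall (n : 'I_N) (x t : R), 0 <= x <= ell -> J t ->
       dt J (C n) x t = Av ell q m E u alpha C n x t)
  /\ antisymmetric_on ell J (@Av R ell q m E u alpha N).
Proof.
split; last exact: Av_antisymmetric.
move=> C _ dC disc n x t xl Jt; apply/eqP; rewrite -subr_eq0.
rewrite -(projected_equation _ _ _ _ _ _ _ _ ell_gt0 J_itv J_nontrivial
  alpha_gt0 _ dC _ _ _ xl Jt).
by apply/eqP; exact: disc.
Qed.
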